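(* Let $H$ be a subgroup of $PL_o(I)$. Then $H$ is non-solvable if and only if $H$ contains a subgroup isomorphic to $W=\bigoplus_{i\in\mathbf{N}}W_i$.
   Context: $PL_o(I)$ is the group of orientation-preserving piecewise-linear homeomorphisms of $I=[0,1]$ with finitely many breaks in slope. For a group $A$, $A\wr\mathbf{Z}=(\bigoplus_{i\in\mathbf{Z}}A)\rtimes\mathbf{Z}$ is the restricted wreath product with $\mathbf{Z}$ acting by index shift. $\mathbf{N}$ is the set of positive integers. Define $W_0$ to be the trivial group and $W_i=W_{i-1}\wr\mathbf{Z}$ for $i\in\mathbf{N}$, so $W_i=(\cdots((\mathbf{Z}\wr\mathbf{Z})\wr\mathbf{Z})\cdots)\wr\mathbf{Z}$ with $i$ copies of $\mathbf{Z}$. *)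

(* Defs.v *)
From Stdlib Require Import Reals ZArith.

Local Open Scope R_scope.

(** * The group PL_o(I)
   Elements of PL_o(I) are represented as functions R -> R that are the
   identity outside [0,1] (a normalisation so that Leibniz equality of
   functions is equality of homeomorphisms of I).  The group law is
   composition. *)

Definition piecewise_linear01 (f : R -> R) : Prop :=
  exists (n : nat) (p : nat -> R),
    p 0%nat = 0 /\ p n = 1 /\
    (forall j : nat, (j < n)%nat -> p j < p (S j)) /\
    (forall j : nat, (j < n)%nat ->
       exists a b : R, forall x : R, p j <= x <= p (S j) -> f x = a * x + b).

Definition PLo (f : R -> R) : Prop :=
  (forall x : R, (x < 0 \/ 1 < x) -> f x = x) /\
  f 0 = 0 /\ f 1 = 1 /\
  (forall x y : R, 0 <= x -> x < y -> y <= 1 -> f x < f y) /\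
  piecewise_linear01 f.

Definition comp (f g : R -> R) : R -> R := fun x => f (g x).

Definition is_inverse (f g : R -> R) : Prop :=
  (forall x, g (f x) = x) /\ (forall x, f (g x) = x).

Definition subgroup_PLo (H : (R -> R) -> Prop) : Prop :=
  (forall f, H f -> PLo f) /\
  H (fun x => x) /\
  (forall f g, H f -> H g -> H (comp f g)) /\
  (forall f g, H f -> is_inverse f g -> H g).

Inductive gen (S : (R -> R) -> Prop) : (R -> R) -> Prop :=
| gen_id : gen S (fun x => x)
| gen_base : forall f, S f -> gen S f
| gen_comp : forall f g, gen S f -> gen S g -> gen S (comp f g)
| gen_inv : forall f g, gen S f -> is_inverse f g -> gen S g.

Definition commutators (K : (R -> R) -> Prop) (h : R -> R) : Prop :=
  exists a b a' b', K a /\ K b /\ is_inverse a a' /\ is_inverse b b' /\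
    h = comp a' (comp b' (comp a b)).

Fixpoint derived (n : nat) (H : (R -> R) -> Prop) : (R -> R) -> Prop :=
  match n with
  | O => H
  | S k => gen (commutators (derived k H))
  end.

Definition solvable (H : (R -> R) -> Prop) : Prop :=
  exists n : nat, forall f, derived n H f -> f = (fun x => x).

(** * Iterated wreath products W_i
   W_0 = 1,  W_{k+1} = W_k wr Z = (⊕_{z∈Z} W_k) ⋊ Z.
   An element of W_{k+1} is a pair (f, m) with f : Z -> W_k finitely
   supported, m : Z; Z acts by shift:
     (f, m) (g, n) = (z |-> f z * g (z - m), m + n). *)

Fixpoint Wty (i : nat) : Type :=
  match i with
  | O => unit
  | S k => ((Z -> Wty k) * Z)%type
  end.

Fixpoint Wone (i : nat) : Wty i :=
  match i return Wty i with
  | O => tt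
  | S k => (fun _ => Wone k, 0%Z)
  end.

Fixpoint Wmul (i : nat) : Wty i -> Wty i -> Wty i :=
  match i return Wty i -> Wty i -> Wty i with
  | O => fun _ _ => tt
  | S k => fun x y =>
      (fun z => Wmul k (fst x z) (fst y (z - snd x)%Z), (snd x + snd y)%Z)
  end.

Fixpoint Win (i : nat) : Wty i -> Prop :=
  match i return Wty i -> Prop with
  | O => fun _ => True
  | S k => fun x =>
      (forall z : Z, Win k (fst x z)) /\
      exists N : Z, forall z : Z, (N < Z.abs z)%Z -> fst x z = Wone k
  end.

(** * W = ⊕_{i ∈ N} W_i  (N = positive integers); the component of index
    j : nat is W_{j+1}. *)
Definition Wsum : Type := forall j : nat, Wty (S j).

Definition Wsum_in (w : Wsum) : Prop :=
  (forall j, Win (S j) (w j)) /\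
  exists N : nat, forall j, (N < j)%nat -> w j = Wone (S j).

Definition Wsum_mul (v w : Wsum) : Wsum := fun j => Wmul (S j) (v j) (w j).

Definition contains_copy_of_W (H : (R -> R) -> Prop) : Prop :=
  exists phi : Wsum -> (R -> R),
    (forall w, Wsum_in w -> H (phi w)) /\
    (forall v w, Wsum_in v -> Wsum_in w ->
       phi (Wsum_mul v w) = comp (phi v) (phi w)) /\
    (forall v w, Wsum_in v -> Wsum_in w -> phi v = phi w -> v = w).

(* Main.v *)
(** Elements of the derived group K' of a subgroup K have trivial germs at the
    global fixed points of K, because one-sided derivatives there are
    multiplicative; by compactness each of them is supported in finitely many
    intervals without global fixed points of K.  Any finite list of such
    intervals is displaced simultaneously by a single element g of K.  Hence a
    finitely generated copy of W_n in K' and its conjugates by the powers of g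
    have disjoint supports, and together with g it generates a copy of W_{n+1}
    in K; so K contains W_{n+1} as soon as its n-th derived group is
    nontrivial.  Displacing copies of W_1, W_2, ... inside H' from one another
    gives the direct sum.  Conversely the derived group of W_{n+1} has a
    subgroup mapping onto W_n, so W is not solvable. *)

Require Import Defs.
From Stdlib Require Import Reals ZArith.
From Stdlib Require Import Lra Lia List Classical ClassicalEpsilon FunctionalExtensionality.

Local Open Scope R_scope.

(** * Groups of increasing bijections of the line *)

Definition strictly_increasing (f : R -> R) : Prop :=
  forall x y, x < y -> f x < f y.

(** The displacement arguments depend on the order of the line alone, so they are carried out for
    groups of increasing bijections without reference to slopes. *)
Definition increasing_group (K : (R -> R) -> Prop) : Prop :=
  (forall f, K f -> strictly_increasing f) /\
  K (fun x => x) /\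
  (forall f g, K f -> K g -> K (comp f g)) /\
  (forall f, K f -> exists f', K f' /\ is_inverse f f').

Definition globally_fixed (K : (R -> R) -> Prop) (x : R) : Prop :=
  forall u, K u -> u x = x.

Definition covers (l : list (R * R)) (x : R) : Prop :=
  exists I, In I l /\ fst I <= x <= snd I.

(** Such a list stands for a compact set that avoids the global fixed points. The intervals may
    overlap, so that covers can be united by concatenation. *)
Definition fixed_point_free (K : (R -> R) -> Prop) (l : list (R * R)) : Prop :=
  (forall I, In I l -> fst I <= snd I) /\
  (forall x, covers l x -> ~ globally_fixed K x).

Definition supported_in (S : R -> Prop) (f : R -> R) : Prop :=
  forall x, ~ S x -> f x = x.

Lemma si_le f x y : strictly_increasing f -> x <= y -> f x <= f y.
Proof.
  intros Hf [H| ->]; [left; auto | lra].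
Qed.

Lemma si_lt_rev f x y : strictly_increasing f -> f x < f y -> x < y.
Proof.
  intros Hf H. destruct (Rlt_le_dec x y) as [|Hyx]; [assumption|].
  apply (si_le f) in Hyx; [lra | assumption].
Qed.

Lemma si_inj f x y : strictly_increasing f -> f x = f y -> x = y.
Proof.
  intros Hf E. destruct (Rtotal_order x y) as [H|[H|H]]; trivial;
    apply Hf in H; lra.
Qed.

Lemma inverse_unique f g g' : is_inverse f g -> is_inverse f g' -> g = g'.
Proof.
  intros [H1 _] [_ H2]. apply functional_extensionality; intro y.
  rewrite <- (H2 y) at 1. apply H1.
Qed.

(** * Displacing intervals *)

Lemma covers_app l1 l2 x : covers (l1 ++ l2) x <-> covers l1 x \/ covers l2 x.
Proof.
  unfold covers; split.
  - intros [I [HI Hx]]. apply in_app_or in HI as [HI|HI]; [left|right]; eauto.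
  - intros [[I [HI Hx]]|[I [HI Hx]]]; exists I; split; auto using in_or_app.
Qed.

Lemma fixed_point_free_app K l1 l2 :
  fixed_point_free K l1 -> fixed_point_free K l2 ->
  fixed_point_free K (l1 ++ l2).
Proof.
  intros [A1 B1] [A2 B2]; split.
  - intros I HI. apply in_app_or in HI as [HI|HI]; auto.
  - intros x Hx. apply covers_app in Hx as [Hx|Hx]; auto.
Qed.

(** If no element took [c] beyond [d], the supremum of the orbit of [c] would lie in [c, d]. As [K]
    permutes the orbit, it would fix this supremum. *)
Lemma displace_interval K c d :
  increasing_group K -> c <= d ->
  (forall x, c <= x <= d -> ~ globally_fixed K x) ->
  exists u, K u /\ d < u c.
Proof.
  intros (HI & H1 & HC & HV) Hcd Hfree.
  apply NNPP; intro Hno.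
  assert (Hb : forall u, K u -> u c <= d).
  { intros u Ku. apply Rnot_lt_le; intro. apply Hno; eauto. }
  destruct (completeness (fun y => exists u, K u /\ y = u c)) as [s [Hs1 Hs2]].
  - exists d. intros y (u & Ku & ->); auto.
  - exists c. exists (fun x => x); auto.
  - assert (Hle : forall u, K u -> s <= u s).
    { intros u Ku. apply Hs2. intros y (v & Kv & ->).
      destruct (HV u Ku) as (u' & Ku' & E1 & E2).
      rewrite <- (E2 (v c)). apply si_le; [auto|].
      apply Hs1. exists (comp u' v). split; [auto | reflexivity]. }
    apply (Hfree s).
    + split.
      * apply Hs1. exists (fun x => x); auto.
      * apply Hs2. intros y (u & Ku & ->); auto.
    + intros u Ku. apply Rle_antisym; [|auto].
      destruct (HV u Ku) as (u' & Ku' & E1 & E2).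
      rewrite <- (E2 s) at 2. apply si_le; auto.
Qed.

Definition hull_with (u : R -> R) (I : R * R) : R * R :=
  (Rmin (fst I) (u (fst I)), Rmax (snd I) (u (snd I))).

(** A point fixed by the increasing map [u] and lying strictly to one side of an interval lies on
    the same side of its image. A global fixed point in the hull would therefore lie in the interval
    itself. *)
Lemma fixed_point_free_hull K u l :
  K u -> strictly_increasing u -> fixed_point_free K l ->
  fixed_point_free K (map (hull_with u) l).
Proof.
  intros Ku Hu [Hl Hf]; split.
  - intros I' HI'. apply in_map_iff in HI' as (I & <- & HI).
    specialize (Hl I HI). unfold hull_with; simpl.
    pose proof (Rmin_l (fst I) (u (fst I))). pose proof (Rmax_l (snd I) (u (snd I))).
    lra.
  - intros x (I' & HI' & Hx) Hfix. apply in_map_iff in HI' as (I & <- & HI).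
    apply (Hf x); [|assumption]. exists I; split; [assumption|].
    unfold hull_with in Hx; simpl in Hx. pose proof (Hfix u Ku) as E.
    split; apply Rnot_lt_le; intro Hlt; pose proof (Hu _ _ Hlt) as Hlt'; rewrite E in Hlt'.
    + pose proof (Rmin_glb_lt _ _ _ Hlt Hlt'). lra.
    + pose proof (Rmax_lub_lt _ _ _ Hlt Hlt'). lra.
Qed.

Definition displaces (g : R -> R) (I : R * R) : Prop :=
  snd I < g (fst I) \/ g (snd I) < fst I.

(* With [u] displacing the first interval [c, d] and [g] displacing the hulls
   of the others with their images under [u], both [g u] and [u^-1 g] displace
   the others, and one of the two displaces [c, d]:
   [g (u c) <= d] forces [g d < u c]. *)
Lemma displace_list K l :
  increasing_group K -> fixed_point_free K l ->
  exists g, K g /\ forall I, In I l -> displaces g I.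
Proof.
  intros HK. pose proof HK as (HI & H1 & HC & HV).
  remember (length l) as n eqn:Hn. revert l Hn.
  induction n as [|n IH]; intros l Hn Hl.
  - destruct l; [|discriminate]. exists (fun x => x). split; [assumption|].
    intros I [].
  - destruct l as [|[c d] l]; [discriminate|]. injection Hn as Hn.
    destruct Hl as [Hle Hfree].
    destruct (displace_interval K c d) as (u & Ku & Hu); trivial.
    { apply (Hle (c, d)); left; reflexivity. }
    { intros x Hx. apply Hfree. exists (c, d); split; [left|]; auto. }
    destruct (HV u Ku) as (u' & Ku' & E1 & E2).
    pose proof (HI u Ku) as Iu.
    destruct (IH (map (hull_with u) l)) as (g & Kg & Hg).
    { rewrite length_map; assumption. }
    { apply fixed_point_free_hull; trivial. split.
      - intros I HIn. apply Hle; right; assumption.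
      - intros x (I & HIn & Hx). apply Hfree. exists I; split; [right|]; assumption. }
    pose proof (HI g Kg) as Ig.
    assert (Hrest : forall I, In I l ->
              displaces (comp g u) I /\ displaces (comp u' g) I).
    { intros I HIn. specialize (Hg _ (in_map (hull_with u) _ _ HIn)).
      unfold displaces, hull_with, comp in *; simpl in Hg.
      set (lo := Rmin _ _) in Hg. set (hi := Rmax _ _) in Hg.
      assert (L1 : lo <= fst I) by apply Rmin_l.
      assert (L2 : lo <= u (fst I)) by apply Rmin_r.
      assert (U1 : snd I <= hi) by apply Rmax_l.
      assert (U2 : u (snd I) <= hi) by apply Rmax_r.
      apply (si_le g) in L1, L2, U1 as U1', U2 as U2'; trivial.
      pose proof (Rmin_l (fst I) (u (fst I))). pose proof (Rmin_r (fst I) (u (fst I))).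
      fold lo in H, H0.
      destruct Hg as [Hg|Hg]; split.
      - left; lra.
      - left. apply (si_lt_rev u); trivial. rewrite E2; lra.
      - right; lra.
      - right. apply (si_lt_rev u); trivial. rewrite E2; lra. }
    destruct (Rlt_le_dec d (g (u c))) as [Hd|Hd].
    + exists (comp g u). split; [auto|]. intros I [<-|HIn].
      * left; assumption.
      * apply Hrest; assumption.
    + exists (comp u' g). split; [auto|]. intros I [<-|HIn].
      * right. unfold comp; simpl. apply (si_lt_rev u); trivial. rewrite E2.
        assert (g d < g (u c)) by auto. lra.
      * apply Hrest; assumption.
Qed.

(** This prepares for the joins of pairs of intervals: a join may contain a global fixed point, and
    then it cannot be displaced and has to be set aside. *)
Lemma fixed_point_free_select K (l : list (R * R)) :
  (forall I, In I l -> fst I <= snd I) ->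
  exists l', fixed_point_free K l' /\
    forall I, In I l ->
      In I l' \/ exists p, fst I <= p <= snd I /\ globally_fixed K p.
Proof.
  induction l as [|J l IH]; intros Hl.
  - exists nil. split; [|intros I []]. split; [intros I []|].
    intros x (I & [] & _).
  - destruct IH as (l' & Hl' & H); [intros; apply Hl; right; assumption|].
    destruct (classic (exists p, fst J <= p <= snd J /\ globally_fixed K p)) as [Hp|Hp].
    + exists l'. split; [assumption|]. intros I [<-|HI]; auto.
    + exists (J :: l'). split.
      * apply (fixed_point_free_app K (J :: nil) l'); [|assumption]. split.
        -- intros I [<-|[]]. apply Hl; left; reflexivity.
        -- intros x (I & [<-|[]] & Hx) Hf. apply Hp. eauto.
      * intros I [<-|HI]; [left; left; reflexivity|].
        destruct (H I HI); [left; right|right]; assumption.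
Qed.

Definition join (IJ : (R * R) * (R * R)) : R * R :=
  (Rmin (fst (fst IJ)) (fst (snd IJ)), Rmax (snd (fst IJ)) (snd (snd IJ))).

Fixpoint iterate (n : nat) (g : R -> R) : R -> R :=
  match n with O => fun x => x | S k => comp g (iterate k g) end.

Lemma iterate_si n g : strictly_increasing g -> strictly_increasing (iterate n g).
Proof.
  intros Hg. induction n as [|n IH]; intros x y Hxy; simpl; [assumption|].
  apply Hg, IH, Hxy.
Qed.

(** An element that displaces the join of [I] and [J] moves [I] off [J], and so do its positive
    powers. If the join contains a global fixed point, this point separates [I] from [J], and no
    power can carry a point across it. *)
Lemma displace_cover K l :
  increasing_group K -> fixed_point_free K l ->
  exists g, K g /\
    forall n x, covers l x -> ~ covers l (iterate (S n) g x).
Proof.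
  intros HK Hl. pose proof HK as (HI & H1 & HC & HV).
  destruct (fixed_point_free_select K (map join (list_prod l l)))
    as (l' & Hl' & Hsel).
  { intros I' HI'. apply in_map_iff in HI' as ([I J] & <- & HIJ).
    apply in_prod_iff in HIJ as [HIl HJl].
    pose proof (proj1 Hl _ HIl). unfold join; simpl.
    pose proof (Rmin_l (fst I) (fst J)). pose proof (Rmax_l (snd I) (snd J)). lra. }
  destruct (displace_list K l' HK Hl') as (g & Kg & Hg).
  exists g. split; [assumption|].
  pose proof (HI g Kg) as Ig.
  intros n x (I & HIl & Hx) (J & HJl & Hy).
  specialize (Hsel (join (I, J))). specialize (Hg (join (I, J))).
  pose proof (proj2 Hl) as Hfree.
  unfold displaces, join in *; simpl fst in *; simpl snd in *.
  set (lo := Rmin _ _) in *. set (hi := Rmax _ _) in *.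
  assert (L1 : lo <= fst I) by apply Rmin_l.
  assert (L2 : lo <= fst J) by apply Rmin_r.
  assert (U1 : snd I <= hi) by apply Rmax_l.
  assert (U2 : snd J <= hi) by apply Rmax_r.
  pose proof (iterate_si (S n) g Ig) as Ign.
  destruct Hsel as [Hin|(p & Hp & Hfix)].
  { apply (in_map join _ (I, J)), in_prod; assumption. }
  - destruct (Hg Hin) as [Hr|Hr].
    (* As [lo <= hi], every further application of [g] keeps the image of [lo] beyond [hi]. *)
    + assert (Hit : hi < iterate (S n) g lo).
      { clear - Hr Ig L1 U1 Hx. induction n as [|n IH]; [assumption|].
        change (hi < g (iterate (S n) g lo)).
        assert (g lo < g (iterate (S n) g lo)) by (apply Ig; lra). lra. }
      assert (iterate (S n) g lo <= iterate (S n) g x) by (apply si_le; trivial; lra).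
      lra.
    + assert (Hit : iterate (S n) g hi < lo).
      { clear - Hr Ig L1 U1 Hx. induction n as [|n IH]; [assumption|].
        change (g (iterate (S n) g hi) < lo).
        assert (g (iterate (S n) g hi) < g hi) by (apply Ig; lra). lra. }
      assert (iterate (S n) g x <= iterate (S n) g hi) by (apply si_le; trivial; lra).
      lra.
  (* [x] and its image lie on the same side of [p]. Since [p] is in neither [I] nor [J], both
     intervals lie on that side, and so does their join, which contains [p]. *)
  - assert (Ep : iterate (S n) g p = p).
    { clear - Hfix Kg. induction (S n) as [|m IH]; [reflexivity|].
      simpl. unfold comp. rewrite IH. auto. }
    assert (HpI : ~ (fst I <= p <= snd I)).
    { intro. apply (Hfree p); [exists I; auto | assumption]. }
    assert (HpJ : ~ (fst J <= p <= snd J)).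
    { intro. apply (Hfree p); [exists J; auto | assumption]. }
    destruct (Rtotal_order x p) as [Hlt|[->|Hlt]]; [|tauto|];
      pose proof (Ign _ _ Hlt) as Hlt'; rewrite Ep in Hlt'.
    + assert (hi < p) by (apply Rmax_lub_lt; apply Rnot_le_lt; intro;
        [apply HpI|apply HpJ]; lra).
      lra.
    + assert (p < lo) by (apply Rmin_glb_lt; apply Rnot_le_lt; intro;
        [apply HpI|apply HpJ]; lra).
      lra.
Qed.

(** * Piecewise linear homeomorphisms *)

(** The half-open form ensures that the piece extends to the right of [x], as right germs require;
    [locate_left] is its mirror image. *)
Lemma locate_right (q : nat -> R) n x :
  q 0%nat <= x < q n -> exists j, (j < n)%nat /\ q j <= x < q (S j).
Proof.
  induction n as [|n IH]; intros H; [lra|].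
  destruct (Rlt_le_dec x (q n)) as [Hx|Hx].
  - destruct IH as (j & Hj & Hq); [lra|]. exists j; split; [lia|assumption].
  - exists n; split; [lia|lra].
Qed.

Lemma locate_left (q : nat -> R) n x :
  q 0%nat < x <= q n -> exists j, (j < n)%nat /\ q j < x <= q (S j).
Proof.
  induction n as [|n IH]; intros H; [lra|].
  destruct (Rlt_le_dec (q n) x) as [Hx|Hx].
  - exists n; split; [lia|lra].
  - destruct IH as (j & Hj & Hq); [lra|]. exists j; split; [lia|assumption].
Qed.

Lemma PLo_si f : PLo f -> strictly_increasing f.
Proof.
  intros (Hout & H0 & H1 & Hin & _).
  assert (Hbd : forall x, 0 <= x <= 1 -> 0 <= f x <= 1).
  { intros x Hx. split.
    - destruct (Req_dec x 0) as [->|Hx0]; [lra|].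
      assert (f 0 < f x) by (apply Hin; lra). lra.
    - destruct (Req_dec x 1) as [->|Hx1]; [lra|].
      assert (f x < f 1) by (apply Hin; lra). lra. }
  intros x y Hxy.
  destruct (classic (0 <= x <= 1)) as [Hx|Hx];
    destruct (classic (0 <= y <= 1)) as [Hy|Hy].
  - apply Hin; lra.
  - rewrite (Hout y) by lra. specialize (Hbd x Hx). lra.
  - rewrite (Hout x) by lra. specialize (Hbd y Hy). lra.
  - rewrite !Hout by lra. assumption.
Qed.

Lemma PLo_surj f : PLo f -> forall y, exists x, f x = y.
Proof.
  intros Hf y. pose proof (PLo_si f Hf) as Hi.
  destruct Hf as (Hout & H0 & H1 & _ & n & p & Hp0 & Hpn & Hinc & Hlin).
  destruct (classic (0 <= y < 1)) as [Hy|Hy].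
  (* [y] lies between the images of two consecutive breakpoints, and the linear equation on that
     piece is solved for the preimage. *)
  - destruct (locate_right (fun j => f (p j)) n y) as (j & Hj & Hq).
    { rewrite Hp0, Hpn; lra. }
    destruct (Hlin j Hj) as (a & b & Hab). specialize (Hinc j Hj).
    pose proof (Hab (p j) ltac:(lra)) as Ej.
    pose proof (Hab (p (S j)) ltac:(lra)) as Ej'.
    assert (Ha : 0 < a) by (specialize (Hi _ _ Hinc); nra).
    assert (Ey : a * ((y - b) / a) + b = y) by (field; lra).
    exists ((y - b) / a). rewrite Hab; [assumption|].
    split; apply Rnot_lt_le; intro; nra.
  - destruct (Req_dec y 1) as [->|Hy1]; [exists 1; assumption|].
    exists y. apply Hout; lra.
Qed.

Lemma PLo_inverse f : PLo f -> exists f', is_inverse f f'.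
Proof.
  intros Hf. exists (fun y => epsilon (inhabits 0) (fun x => f x = y)).
  assert (E : forall y, f (epsilon (inhabits 0) (fun x => f x = y)) = y).
  { intro y. apply (epsilon_spec (inhabits 0) (fun x => f x = y)).
    apply PLo_surj, Hf. }
  split; [|assumption]. intro x. apply (si_inj f); [apply PLo_si, Hf|]. apply E.
Qed.

Lemma subgroup_increasing K : subgroup_PLo K -> increasing_group K.
Proof.
  intros (HP & H1 & HC & HV). repeat split; auto.
  - intros f Kf. apply PLo_si; auto.
  - intros f Kf. destruct (PLo_inverse f) as [f' Hf']; [auto|].
    exists f'; split; eauto.
Qed.

(** * Generated and derived subgroups *)

Lemma gen_sub K S : subgroup_PLo K -> (forall f, S f -> K f) ->
  forall f, gen S f -> K f.
Proof.
  intros (HP & H1 & HC & HV) HS f Hf. induction Hf; eauto.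
Qed.

Lemma gen_mono (S T : (R -> R) -> Prop) :
  (forall f, S f -> T f) -> forall f, gen S f -> gen T f.
Proof.
  intros HS f Hf. induction Hf; [constructor 1|constructor 2; auto|
    constructor 3; auto|econstructor 4; eauto].
Qed.

Lemma derived1_sub K : subgroup_PLo K -> forall f, derived 1 K f -> K f.
Proof.
  intros HK. apply gen_sub; [assumption|].
  pose proof HK as (HP & H1 & HC & HV).
  intros f (a & b & a' & b' & Ka & Kb & Ia & Ib & ->).
  apply HC; [eauto|]. apply HC; [eauto|]. apply HC; assumption.
Qed.

Lemma subgroup_derived1 K : subgroup_PLo K -> subgroup_PLo (derived 1 K).
Proof.
  intros HK. split; [|split; [|split]].
  - intros f Hf. apply HK, derived1_sub; assumption.
  - apply gen_id.
  - apply gen_comp.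
  - apply gen_inv.
Qed.

(** [derived] takes the last commutator subgroup outermost, whereas the inductions on [n] below
    replace [K] by its derived group at the start. *)
Lemma derived_succ n K : derived n (derived 1 K) = derived (S n) K.
Proof.
  induction n as [|n IH]; [reflexivity|].
  change (derived (S n) (derived 1 K)) with (gen (commutators (derived n (derived 1 K)))).
  rewrite IH. reflexivity.
Qed.

(* One-sided germ at [p], to the right for [sigma = 1] and to the left for
   [sigma = -1]. *)
Definition germ (sigma : R) (f : R -> R) (p s : R) : Prop :=
  exists e, 0 < e /\
    forall t, 0 <= t <= e -> f (p + sigma * t) = p + sigma * (s * t).

Lemma PLo_germ sigma f p :
  sigma = 1 \/ sigma = -1 -> PLo f -> f p = p ->
  exists s, 0 < s /\ germ sigma f p s.
Proof.
  intros Hs Hf Hp. pose proof (PLo_si f Hf) as Hi.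
  destruct Hf as (Hout & H0 & H1 & _ & n & q & Hq0 & Hqn & Hinc & Hlin).
  (* On the side [sigma] of [p], either [f] is the identity near [p], or a short segment starting at
     [p] lies within one linear piece. *)
  assert (Hlocal : (exists e, 0 < e /\ forall t, 0 <= t <= e ->
                      f (p + sigma * t) = p + sigma * t) \/
            exists j, (j < n)%nat /\ q j <= p <= q (S j) /\
              exists e, 0 < e /\ q j <= p + sigma * e <= q (S j)).
  { assert (Hout' : forall t, t = 0 \/ p + sigma * t < 0 \/ 1 < p + sigma * t ->
                      f (p + sigma * t) = p + sigma * t).
    { intros t [->|Ht]; [|auto]. rewrite Rmult_0_r, Rplus_0_r; assumption. }
    (* [(1 + sigma) / 2] is the endpoint of [0,1] whose side [sigma] points out of the interval: 1
       on the right, 0 on the left. *)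
    destruct (classic (p <> (1 + sigma) / 2 /\ 0 <= p <= 1)) as [[Hps Hp01]|Hps].
    - right. destruct Hs as [-> | ->].
      + destruct (locate_right q n p) as (j & Hj & Hpj); [lra|].
        exists j; repeat split; [assumption|lra|lra|].
        exists (q (S j) - p). lra.
      + destruct (locate_left q n p) as (j & Hj & Hpj); [lra|].
        exists j; repeat split; [assumption|lra|lra|].
        exists (p - q j). lra.
    - left.
      destruct (Rlt_le_dec p 0) as [Hp0|Hp0].
      { exists (- p / 2). split; [lra|]. intros t Ht. apply Hout'.
        destruct Hs as [-> | ->]; lra. }
      destruct (Rlt_le_dec 1 p) as [Hp1|Hp1].
      { exists ((p - 1) / 2). split; [lra|]. intros t Ht. apply Hout'.
        destruct Hs as [-> | ->]; lra. }
      exists 1. split; [lra|]. intros t Ht. apply Hout'.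
      destruct (Req_dec t 0); [left; assumption|right].
      assert (p = (1 + sigma) / 2) by (apply NNPP; tauto).
      destruct Hs as [-> | ->]; lra. }
  destruct Hlocal as [(e & He & H)|(j & Hj & Hpj & e & He & Hpe)].
  - exists 1. split; [lra|]. exists e. split; [assumption|].
    intros t Ht. rewrite H by assumption. ring.
  - destruct (Hlin j Hj) as (a & b & Hab). specialize (Hinc j Hj).
    pose proof (Hab (q j) ltac:(lra)) as Ej.
    pose proof (Hab (q (S j)) ltac:(lra)) as Ej'.
    pose proof (Hab p Hpj) as Ep.
    exists a. split.
    { specialize (Hi _ _ Hinc). nra. }
    exists e. split; [assumption|]. intros t Ht. rewrite Hab; [lra|].
    destruct Hs as [-> | ->]; lra.
Qed.

Lemma germ_comp sigma f g p s r :
  0 < r -> germ sigma f p s -> germ sigma g p r ->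
  germ sigma (comp f g) p (s * r).
Proof.
  intros Hr (e & He & Hf) (d & Hd & Hg).
  assert (Her : 0 < e / r) by (apply Rdiv_lt_0_compat; assumption).
  exists (Rmin d (e / r)). split; [apply Rmin_glb_lt; assumption|].
  intros t Ht. pose proof (Rmin_l d (e / r)). pose proof (Rmin_r d (e / r)).
  unfold comp. rewrite Hg by lra. rewrite Hf; [ring|].
  assert (e / r * r = e) by (field; lra). nra.
Qed.

Lemma germ_unique sigma f p s r :
  sigma <> 0 -> germ sigma f p s -> germ sigma f p r -> s = r.
Proof.
  intros Hs (e & He & H1) (d & Hd & H2).
  pose proof (Rmin_l e d). pose proof (Rmin_r e d).
  assert (0 < Rmin e d) by (apply Rmin_glb_lt; assumption).
  specialize (H1 (Rmin e d) ltac:(lra)). specialize (H2 (Rmin e d) ltac:(lra)).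
  rewrite H1 in H2. assert (E : sigma * (s * Rmin e d) = sigma * (r * Rmin e d)) by lra.
  apply Rmult_eq_reg_l in E; [|assumption]. apply Rmult_eq_reg_r in E; lra.
Qed.

Lemma germ_inverse sigma f f' p s s' :
  sigma <> 0 -> 0 < s -> is_inverse f f' ->
  germ sigma f p s -> germ sigma f' p s' -> s' * s = 1.
Proof.
  intros Hsg Hs [E _] Gf Gf'.
  apply (germ_unique sigma (comp f' f) p); [assumption|apply germ_comp; assumption|].
  exists 1. split; [lra|]. intros t _. unfold comp. rewrite E. ring.
Qed.

(* The one-sided derivatives at a common fixed point are multiplicative, so
   they are all 1 on commutators. *)
Lemma commutator_germ K h p :
  subgroup_PLo K -> commutators K h -> globally_fixed K p ->
  exists e, 0 < e /\ forall x, p - e <= x <= p + e -> h x = x.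
Proof.
  intros (HP & _ & _ & HV) (a & b & a' & b' & Ka & Kb & Ia & Ib & ->) Hp.
  assert (Ka' : K a') by eauto. assert (Kb' : K b') by eauto.
  set (h := comp a' (comp b' (comp a b))).
  assert (Hside : forall sigma, sigma = 1 \/ sigma = -1 -> germ sigma h p 1).
  { intros sigma Hs. assert (sigma <> 0) by lra.
    destruct (PLo_germ sigma a p) as (s & Hs0 & Gs); auto.
    destruct (PLo_germ sigma b p) as (t & Ht0 & Gt); auto.
    destruct (PLo_germ sigma a' p) as (s' & Hs0' & Gs'); auto.
    destruct (PLo_germ sigma b' p) as (t' & Ht0' & Gt'); auto.
    assert (Es : s' * s = 1) by (apply (germ_inverse sigma a a' p); assumption).
    assert (Et : t' * t = 1) by (apply (germ_inverse sigma b b' p); assumption).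
    replace 1 with (s' * (t' * (s * t))) by (transitivity ((s' * s) * (t' * t)); nra).
    apply germ_comp; trivial; [auto using Rmult_lt_0_compat|].
    apply germ_comp; trivial; [auto using Rmult_lt_0_compat|].
    apply germ_comp; assumption. }
  destruct (Hside 1) as (e & He & Hr); [auto|].
  destruct (Hside (-1)) as (d & Hd & Hl); [auto|].
  pose proof (Rmin_l e d). pose proof (Rmin_r e d).
  exists (Rmin e d). split; [apply Rmin_glb_lt; assumption|].
  intros x Hx. destruct (Rlt_le_dec x p).
  - replace x with (p + -1 * (p - x)) by ring. rewrite Hl by lra. ring.
  - replace x with (p + 1 * (x - p)) by ring. rewrite Hr by lra. ring.
Qed.

(** * Compactness of intervals and supports of elements of the derived group *)

Lemma interval_induction (P : R -> R -> Prop) :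
  (forall a b c, P a b -> P b c -> P a c) ->
  (forall a a' b' b, a <= a' -> a' <= b' -> b' <= b -> P a b -> P a' b') ->
  (forall p, exists e, 0 < e /\ P (p - e) (p + e)) ->
  forall a b, a <= b -> P a b.
Proof.
  intros Hcat Hsub Hloc a b Hab.
  assert (Haa : P a a).
  { destruct (Hloc a) as (e & He & HP). apply (Hsub (a - e) a a (a + e)); trivial; lra. }
  (* The property reaches from [a] to points arbitrarily close to [s]; the neighbourhood of [s] on
     which it holds would carry it beyond [s], so nothing stops it before [b]. *)
  destruct (completeness (fun x => a <= x <= b /\ P a x)) as [s [Hs1 Hs2]].
  - exists b. intros x [Hx _]; lra.
  - exists a. split; [lra|assumption].
  - assert (Has : a <= s) by (apply Hs1; split; [lra|assumption]).
    assert (Hsb : s <= b) by (apply Hs2; intros x [Hx _]; lra).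
    destruct (Hloc s) as (e & He & HP).
    assert (Hx : exists x, s - e < x /\ a <= x <= b /\ P a x).
    { apply NNPP; intro Hno. assert (s <= s - e); [|lra].
      apply Hs2. intros x Hx. apply Rnot_lt_le; intro. apply Hno.
      exists x. tauto. }
    destruct Hx as (x & Hxe & Hx & HPx).
    assert (Hxs : x <= s) by (apply Hs1; auto).
    assert (HPy : P a (Rmin b (s + e))).
    { apply (Hcat a x); [assumption|].
      pose proof (Rmin_r b (s + e)).
      apply (Hsub (s - e) x _ (s + e)); trivial; [lra|apply Rmin_glb; lra]. }
    destruct (Rlt_le_dec b (s + e)) as [Hbe|Hbe].
    + rewrite Rmin_left in HPy by lra. assumption.
    + rewrite Rmin_right in HPy by lra.
      assert (s + e <= s) by (apply Hs1; split; [lra|assumption]). lra.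
Qed.

Lemma moved_interval K p :
  increasing_group K -> ~ globally_fixed K p ->
  exists e, 0 < e /\ fixed_point_free K ((p - e, p + e) :: nil).
Proof.
  intros (HI & _ & _ & HV) Hp.
  (* An element that moves [p] to the left is replaced by its inverse. *)
  assert (Hu : exists u, K u /\ p < u p).
  { apply not_all_ex_not in Hp as [u Hu]. apply imply_to_and in Hu as [Ku Hu].
    destruct (Rtotal_order p (u p)) as [Hlt|[E|Hlt]]; [eauto|congruence|].
    destruct (HV u Ku) as (u' & Ku' & E1 & E2). exists u'. split; [assumption|].
    apply (si_lt_rev u); [auto|]. rewrite E2; assumption. }
  destruct Hu as (u & Ku & Hu).
  destruct (HV u Ku) as (u' & Ku' & E1 & E2).
  assert (Hu' : u' p < p) by (apply (si_lt_rev u); [auto|]; rewrite E2; assumption).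
  (* Half of each displacement keeps the interval around [p] strictly between [u' p] and [u p], so
     [u] moves each of its points to the right. *)
  pose proof (Rmin_l ((u p - p) / 2) ((p - u' p) / 2)).
  pose proof (Rmin_r ((u p - p) / 2) ((p - u' p) / 2)).
  set (e := Rmin _ _) in *.
  assert (0 < e) by (apply Rmin_glb_lt; lra).
  exists e. split; [assumption|]. split.
  - intros I [<-|[]]; simpl; lra.
  - intros x (I & [<-|[]] & Hx) Hfix. simpl in Hx.
    pose proof (Hfix u Ku) as Ex.
    destruct (Rlt_le_dec x p) as [Hxp|Hxp].
    + assert (Hux : u' p < x) by lra. apply (HI u Ku) in Hux. rewrite E2 in Hux. lra.
    + assert (u p <= u x) by (apply si_le; auto). lra.
Qed.

(** By compactness the cover may be found locally: near a global fixed point [h] is the identity and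
    the empty list serves, near any other point [moved_interval] supplies an interval. *)
Lemma commutator_support K h :
  subgroup_PLo K -> commutators K h ->
  exists l, fixed_point_free K l /\ supported_in (covers l) h.
Proof.
  intros HK Hh. pose proof (subgroup_increasing K HK) as HI.
  assert (Hcov : exists l, fixed_point_free K l /\
            forall x, 0 <= x <= 1 -> ~ covers l x -> h x = x).
  { apply (interval_induction (fun a b => exists l, fixed_point_free K l /\
             forall x, a <= x <= b -> ~ covers l x -> h x = x)); [| | |lra].
    - intros a b c (l1 & F1 & H1) (l2 & F2 & H2). exists (l1 ++ l2).
      split; [apply fixed_point_free_app; assumption|].
      intros x Hx Hn. rewrite covers_app in Hn.
      destruct (Rlt_le_dec x b); [apply H1|apply H2]; tauto || lra.
    - intros a a' b' b Ha Hab Hb (l & F & H). exists l. split; [assumption|].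
      intros x Hx. apply H; lra.
    - intros p. destruct (classic (globally_fixed K p)) as [Hp|Hp].
      + destruct (commutator_germ K h p HK Hh Hp) as (e & He & H).
        exists e. split; [assumption|]. exists nil. split; [|auto].
        split; [intros I []|intros x (I & [] & _)].
      + destruct (moved_interval K p HI Hp) as (e & He & F).
        exists e. split; [assumption|]. exists ((p - e, p + e) :: nil).
        split; [assumption|]. intros x Hx Hn. destruct Hn.
        exists (p - e, p + e). split; [left; reflexivity|assumption]. }
  destruct Hcov as (l & F & H). exists l. split; [assumption|].
  intros x Hn. destruct (classic (0 <= x <= 1)) as [Hx|Hx]; [auto|].
  assert (Kh : K h) by (apply derived1_sub; [assumption|apply gen_base, Hh]).
  apply (proj1 HK h Kh). lra.
Qed.

Lemma supported_in_comp S f g :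
  supported_in S f -> supported_in S g -> supported_in S (comp f g).
Proof.
  intros Hf Hg x Hx. unfold comp. rewrite Hg; auto.
Qed.

Lemma supported_in_inverse S f f' :
  is_inverse f f' -> supported_in S f -> supported_in S f'.
Proof.
  intros [E _] Hf x Hx. rewrite <- (Hf x Hx) at 1. apply E.
Qed.

Lemma supported_in_gen S T :
  (forall f, T f -> supported_in S f) -> forall f, gen T f -> supported_in S f.
Proof.
  intros HT f Hf. induction Hf; auto.
  - intros x _; reflexivity.
  - apply supported_in_comp; assumption.
  - eapply supported_in_inverse; eassumption.
Qed.

Lemma supported_in_mono (S T : R -> Prop) f :
  (forall x, S x -> T x) -> supported_in S f -> supported_in T f.
Proof. intros HST Hf x Hx. apply Hf; auto. Qed.

Lemma derived_support K f :
  subgroup_PLo K -> derived 1 K f ->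
  exists l, fixed_point_free K l /\ supported_in (covers l) f.
Proof.
  intros HK Hf. induction Hf as [|f Hf|f g _ (l1 & F1 & S1) _ (l2 & F2 & S2)
                                |f g _ (l & F & HS) Hinv].
  - exists nil. split; [|intros x _; reflexivity].
    split; [intros I []|intros x (I & [] & _)].
  - apply commutator_support; assumption.
  - exists (l1 ++ l2). split; [apply fixed_point_free_app; assumption|].
    apply supported_in_comp; eapply supported_in_mono; try eassumption;
      intros x Hx; apply covers_app; auto.
  - exists l. split; [assumption|]. eapply supported_in_inverse; eassumption.
Qed.

(** One cover serves all elements of the group because it is finitely generated. For this reason the
    embeddings constructed below come with a finite list of generators. *)
Lemma derived_list_support K T :
  subgroup_PLo K -> (forall f, In f T -> derived 1 K f) ->
  exists l, fixed_point_free K l /\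
    forall f, gen (fun f => In f T) f -> supported_in (covers l) f.
Proof.
  intros HK HT.
  assert (H : exists l, fixed_point_free K l /\
            forall f, In f T -> supported_in (covers l) f).
  { induction T as [|f T IH].
    - exists nil. split; [|intros f []].
      split; [intros I []|intros x (I & [] & _)].
    - destruct IH as (l1 & F1 & S1); [intros; apply HT; right; assumption|].
      destruct (derived_support K f) as (l2 & F2 & S2); [assumption|apply HT; left; reflexivity|].
      exists (l2 ++ l1). split; [apply fixed_point_free_app; assumption|].
      intros g [<-|Hg]; (eapply supported_in_mono; [|eauto]);
        intros x Hx; apply covers_app; auto. }
  destruct H as (l & F & H). exists l. split; [assumption|].
  apply supported_in_gen, H.
Qed.

(** * The groups [Wty n] *)

Lemma Wmul_1_l n w : Wmul n (Wone n) w = w.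
Proof.
  induction n as [|n IH]; [destruct w; reflexivity|].
  destruct w as [f m]; simpl. f_equal.
  apply functional_extensionality; intro z. rewrite IH, Z.sub_0_r. reflexivity.
Qed.

Lemma Wmul_1_r n w : Wmul n w (Wone n) = w.
Proof.
  induction n as [|n IH]; [destruct w; reflexivity|].
  destruct w as [f m]; simpl. f_equal; [|apply Z.add_0_r].
  apply functional_extensionality; intro z. apply IH.
Qed.

Lemma Wmul_assoc n u v w : Wmul n u (Wmul n v w) = Wmul n (Wmul n u v) w.
Proof.
  induction n as [|n IH]; [reflexivity|].
  destruct u as [f m], v as [g k], w as [h l]; simpl. f_equal; [|apply Z.add_assoc].
  apply functional_extensionality; intro z. rewrite IH.
  do 2 f_equal. ring.
Qed.

Fixpoint Winv (n : nat) : Wty n -> Wty n :=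
  match n return Wty n -> Wty n with
  | O => fun _ => tt
  | S k => fun x => (fun z => Winv k (fst x (z + snd x)%Z), (- snd x)%Z)
  end.

Lemma Wmul_Vl n w : Wmul n (Winv n w) w = Wone n.
Proof.
  induction n as [|n IH]; [reflexivity|].
  destruct w as [f m]; simpl. f_equal; [|lia].
  apply functional_extensionality; intro z.
  replace (z - - m)%Z with (z + m)%Z by ring. apply IH.
Qed.

Lemma Winv_unique n v w : Wmul n v w = Wone n -> w = Winv n v.
Proof.
  intros E. rewrite <- (Wmul_1_r n (Winv n v)), <- E, Wmul_assoc, Wmul_Vl, Wmul_1_l.
  reflexivity.
Qed.

Lemma Winv_involutive n w : Winv n (Winv n w) = w.
Proof. symmetry. apply Winv_unique, Wmul_Vl. Qed.

Lemma Winv_1 n : Winv n (Wone n) = Wone n.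
Proof. symmetry. apply Winv_unique, Wmul_1_l. Qed.

Lemma Wmul_Vr n w : Wmul n w (Winv n w) = Wone n.
Proof. rewrite <- (Winv_involutive n w) at 1. apply Wmul_Vl. Qed.

Lemma Win_1 n : Win n (Wone n).
Proof.
  induction n as [|n IH]; simpl; [trivial|]. split; [auto|]. exists 0%Z; auto.
Qed.

Lemma Win_mul n v w : Win n v -> Win n w -> Win n (Wmul n v w).
Proof.
  induction n as [|n IH]; [trivial|].
  intros [Hv (N & HN)] [Hw (M & HM)]; simpl. split; [auto|].
  (* The support of the second factor is shifted by [snd v]. *)
  exists (Z.abs N + Z.abs M + Z.abs (snd v))%Z. intros z Hz.
  rewrite HN, HM by lia. apply Wmul_1_l.
Qed.

Lemma Win_inv n w : Win n w -> Win n (Winv n w).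
Proof.
  induction n as [|n IH]; [trivial|].
  intros [Hw (N & HN)]; simpl. split; [auto|].
  exists (Z.abs N + Z.abs (snd w))%Z. intros z Hz.
  rewrite HN by lia. apply Winv_1.
Qed.

Definition embedding (n : nat) (K : (R -> R) -> Prop) (phi : Wty n -> R -> R) : Prop :=
  (forall w, Win n w -> K (phi w)) /\
  (forall v w, Win n v -> Win n w -> phi (Wmul n v w) = comp (phi v) (phi w)) /\
  (forall v w, Win n v -> Win n w -> phi v = phi w -> v = w).

(** The image of the unit is idempotent, and an injective idempotent map is the identity. *)
Lemma embedding_1 n K phi :
  (forall f, K f -> strictly_increasing f) -> embedding n K phi ->
  phi (Wone n) = (fun x => x).
Proof.
  intros HK (Hin & Hmul & _). pose proof (Win_1 n) as W1.
  pose proof (Hmul _ _ W1 W1) as E. rewrite Wmul_1_l in E.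
  apply functional_extensionality; intro x.
  apply (si_inj (phi (Wone n))); [auto|].
  change (phi (Wone n) (phi (Wone n) x)) with (comp (phi (Wone n)) (phi (Wone n)) x).
  rewrite <- E. reflexivity.
Qed.

(** * Glueing functions with disjoint supports *)

(** If [f x] were outside [S], it would be fixed by [f], and injectivity would give [f x = x]. *)
Lemma supported_in_preserves (S : R -> Prop) f x :
  (forall a b, f a = f b -> a = b) -> supported_in S f -> S x -> S (f x).
Proof.
  intros Hi Hf Sx. apply NNPP; intro Hn.
  pose proof (Hi _ _ (Hf _ Hn)) as E. rewrite E in Hn. auto.
Qed.

Section Glue.
Variable I : Type.
Variable inh : inhabited I.
Variable S : I -> R -> Prop.
Hypothesis disjoint : forall i j x, S i x -> S j x -> i = j.

(** The index is the one whose set contains [x]. Outside all the sets [epsilon] returns some index,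
    and every member of a supported family fixes [x]. *)
Definition glue (u : I -> R -> R) : R -> R :=
  fun x => u (epsilon inh (fun i => S i x)) x.

Definition supported_family (u : I -> R -> R) : Prop :=
  forall i, supported_in (S i) (u i).

Lemma glue_in u i x : S i x -> glue u x = u i x.
Proof.
  intro Hx. unfold glue. f_equal. apply (disjoint _ _ x); [|assumption].
  apply (epsilon_spec inh (fun i => S i x)). eauto.
Qed.

Lemma glue_out u x : supported_family u -> (forall i, ~ S i x) -> glue u x = x.
Proof. intros Hu Hx. apply Hu, Hx. Qed.

Lemma glue_comp u v :
  supported_family u -> supported_family v ->
  (forall i a b, v i a = v i b -> a = b) ->
  glue (fun i => comp (u i) (v i)) = comp (glue u) (glue v).
Proof.
  intros Hu Hv Hi. apply functional_extensionality; intro x.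
  destruct (classic (exists i, S i x)) as [[i Hx]|Hx].
  - rewrite (glue_in _ i x Hx). unfold comp. rewrite (glue_in v i x Hx).
    symmetry; apply glue_in.
    apply supported_in_preserves; [apply Hi|apply Hv|assumption].
  - assert (Hx' : forall i, ~ S i x) by eauto.
    unfold comp. rewrite (glue_out v), (glue_out u), glue_out; trivial.
    intro i. apply supported_in_comp; auto.
Qed.

Lemma glue_inj u v :
  supported_family u -> supported_family v -> glue u = glue v ->
  forall i, u i = v i.
Proof.
  intros Hu Hv E i. apply functional_extensionality; intro x.
  destruct (classic (S i x)) as [Hx|Hx].
  - rewrite <- (glue_in u i x), <- (glue_in v i x), E; trivial.
  - rewrite Hu, Hv; trivial.
Qed.

(** With only finitely many nontrivial members the glued map is their product. The induction on [L]
    splits off the member of index [i0], as [u1], from the rest, [u0]. *)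
Lemma glue_closed (G : (R -> R) -> Prop) :
  G (fun x => x) -> (forall f g, G f -> G g -> G (comp f g)) ->
  forall (L : list I) u, supported_family u ->
  (forall i a b, u i a = u i b -> a = b) -> (forall i, G (u i)) ->
  (forall i, ~ In i L -> u i = fun x => x) -> G (glue u).
Proof.
  intros G1 GC. induction L as [|i0 L IH]; intros u Hu Hi HG HL.
  - replace (glue u) with (fun x : R => x); [assumption|].
    apply functional_extensionality; intro x. unfold glue.
    rewrite HL; auto.
  - set (e := fun i => excluded_middle_informative (i = i0)).
    set (u0 := fun i => if e i then (fun x => x) else u i).
    set (u1 := fun i => if e i then u i else (fun x => x)).
    assert (H0 : supported_family u0).
    { intros i x Hx. unfold u0. destruct (e i); [reflexivity|apply Hu, Hx]. }
    assert (H1 : supported_family u1).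
    { intros i x Hx. unfold u1. destruct (e i); [apply Hu, Hx|reflexivity]. }
    assert (E : u = fun i => comp (u0 i) (u1 i)).
    { apply functional_extensionality; intro i. unfold u0, u1.
      destruct (e i); reflexivity. }
    rewrite E, glue_comp; trivial.
    + apply GC.
      * apply IH; trivial; intro i; unfold u0; destruct (e i); eauto.
        intros HnL. apply HL. intros [|]; auto.
      * replace (glue u1) with (u i0); [apply HG|].
        apply functional_extensionality; intro x.
        destruct (classic (S i0 x)) as [Hx|Hx].
        -- rewrite (glue_in _ i0) by assumption. unfold u1.
           destruct (e i0); [reflexivity|congruence].
        -- rewrite Hu by assumption. symmetry. unfold glue, u1.
           destruct (e _) as [->|]; [apply Hu, Hx|reflexivity].
    + intros i a b. unfold u1. destruct (e i); eauto.
Qed.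
End Glue.

(** * Integer powers *)

(** At least one of the two exponents is 0, so with [g'] the inverse of [g] this is the power with
    exponent [z]. *)
Definition zpow (g g' : R -> R) (z : Z) : R -> R :=
  comp (iterate (Z.to_nat z) g) (iterate (Z.to_nat (- z)) g').

Lemma zpow_succ g g' z x :
  is_inverse g g' -> zpow g g' (Z.succ z) x = g (zpow g g' z x).
Proof.
  intros [_ E]. unfold zpow, comp. destruct (Z_lt_le_dec z 0) as [Hz|Hz].
  - replace (Z.to_nat (Z.succ z)) with 0%nat by lia.
    replace (Z.to_nat z) with 0%nat by lia.
    replace (Z.to_nat (- z)) with (Datatypes.S (Z.to_nat (- Z.succ z))) by lia.
    simpl. unfold comp. rewrite E. reflexivity.
  - replace (Z.to_nat (Z.succ z)) with (Datatypes.S (Z.to_nat z)) by lia.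
    replace (Z.to_nat (- z)) with 0%nat by lia.
    replace (Z.to_nat (- Z.succ z)) with 0%nat by lia. reflexivity.
Qed.

Lemma zpow_add g g' a b x :
  is_inverse g g' -> zpow g g' (a + b) x = zpow g g' a (zpow g g' b x).
Proof.
  intros Hg. induction a as [|a IH|a IH] using Z.peano_ind.
  - reflexivity.
  - rewrite Z.add_succ_l, !zpow_succ, IH; trivial.
  - pose proof (zpow_succ g g' (Z.pred a) (zpow g g' b x) Hg) as E1.
    pose proof (zpow_succ g g' (Z.pred a + b) x Hg) as E2.
    rewrite Z.succ_pred in E1.
    replace (Z.succ (Z.pred a + b)) with (a + b)%Z in E2 by lia.
    rewrite IH, E1 in E2. destruct Hg as [Eg _].
    rewrite <- (Eg (zpow g g' (Z.pred a + b) x)), <- E2. apply Eg.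
Qed.

Lemma zpow_opp g g' z : is_inverse g g' ->
  is_inverse (zpow g g' z) (zpow g g' (- z)).
Proof.
  intros Hg; split; intro x; rewrite <- zpow_add by assumption.
  - rewrite Z.add_opp_diag_l; reflexivity.
  - rewrite Z.add_opp_diag_r; reflexivity.
Qed.

Lemma zpow_closed (G : (R -> R) -> Prop) g g' z :
  G (fun x => x) -> (forall f h, G f -> G h -> G (comp f h)) ->
  G g -> G g' -> G (zpow g g' z).
Proof.
  intros G1 GC Gg Gg'.
  assert (H : forall n f, G f -> G (iterate n f)).
  { intros n f Gf. induction n; simpl; auto. }
  apply GC; auto.
Qed.

Lemma zpow_displaces g g' (S : R -> Prop) z x :
  is_inverse g g' ->
  (forall n x, S x -> ~ S (iterate (Datatypes.S n) g x)) ->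
  S x -> S (zpow g g' z x) -> z = 0%Z.
Proof.
  intros Hg Hd Sx Sy.
  assert (Hpos : forall z y, (0 < z)%Z -> S y -> ~ S (zpow g g' z y)).
  { intros n y Hn Hy. unfold zpow, comp.
    replace (Z.to_nat (- n)) with 0%nat by lia.
    replace (Z.to_nat n) with (Datatypes.S (Z.to_nat (n - 1))) by lia.
    apply Hd, Hy. }
  destruct (Z.lt_trichotomy z 0) as [Hz|[Hz|Hz]]; [exfalso|assumption|exfalso].
  (* The opposite, positive power would bring the image of [x] back into [S]. *)
  - apply (Hpos (- z)%Z _ ltac:(lia) Sy).
    destruct (zpow_opp g g' z Hg) as [E _]. rewrite E. assumption.
  - apply (Hpos z x Hz Sx Sy).
Qed.

Definition conjugate (g : R -> R) (g' : R -> R) (h : R -> R) : R -> R :=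
  comp g (comp h g').

Lemma conj_supported g g' S h :
  is_inverse g g' -> supported_in S h ->
  supported_in (fun x => S (g' x)) (conjugate g g' h).
Proof.
  intros [_ E] Hh x Hx. unfold conjugate, comp. rewrite Hh by assumption. apply E.
Qed.

Lemma conj_comp g g' f h :
  is_inverse g g' -> conjugate g g' (comp f h) = comp (conjugate g g' f) (conjugate g g' h).
Proof.
  intros [E _]. apply functional_extensionality; intro x.
  unfold conjugate, comp. rewrite E. reflexivity.
Qed.

Lemma conj_inj g g' f h :
  is_inverse g g' -> conjugate g g' f = conjugate g g' h -> f = h.
Proof.
  intros [E _] H. apply functional_extensionality; intro x.
  apply (f_equal (fun k => g' (k (g x)))) in H. unfold conjugate, comp in H.
  rewrite !E in H. assumption.
Qed.

(** * Embedding iterated wreath products *)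

Lemma increasing_group_inj K f : increasing_group K -> K f -> forall a b, f a = f b -> a = b.
Proof. intros HK Kf a b. apply si_inj. apply HK, Kf. Qed.

(** A pair (f, m) is sent to the power [m] of [g] followed by the glued conjugates of the maps
    [phi (f z)]. The generator [g] is added to [T], so the new copy again lies in a finitely
    generated group. *)
Lemma embedding_succ n K :
  subgroup_PLo K -> (exists p, ~ globally_fixed K p) ->
  (exists T phi, (forall f, In f T -> derived 1 K f) /\
     embedding n (gen (fun f => In f T)) phi) ->
  exists T phi, (forall f, In f T -> K f) /\
     embedding (S n) (gen (fun f => In f T)) phi.
Proof.
  intros HK (p & Hp) (T & phi & HT & Hphi).
  pose proof (subgroup_increasing K HK) as HIK.
  destruct (derived_list_support K T HK HT) as (l1 & F1 & S1).
  destruct (moved_interval K p HIK Hp) as (e & He & F2).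
  (* The interval around the moved point [p] makes the cover nonempty even if [phi] is trivial; the
     image of [p] will reveal the exponent [m]. *)
  set (l := ((p - e, p + e) :: nil) ++ l1).
  assert (F : fixed_point_free K l) by (apply fixed_point_free_app; assumption).
  assert (Hpl : covers l p).
  { exists (p - e, p + e). split; [left; reflexivity|simpl; lra]. }
  destruct (displace_cover K l HIK F) as (g & Kg & Hd).
  assert (Hg' : exists g', K g' /\ is_inverse g g') by (apply HIK, Kg).
  destruct Hg' as (g' & Kg' & Hg).
  set (G := gen (fun f => In f (g :: T))).
  assert (HGK : forall f, G f -> K f).
  { apply gen_sub; [assumption|]. intros f [<-|Hf]; [assumption|].
    apply derived1_sub; auto. }
  assert (HTG : forall f, gen (fun f => In f T) f -> G f).
  { apply gen_mono. intros f Hf; right; assumption. }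
  assert (Gz : forall z, G (zpow g g' z)).
  { assert (G g) by (apply gen_base; left; reflexivity).
    intro z. apply zpow_closed; trivial; [apply gen_id|apply gen_comp|].
    apply (gen_inv _ g); assumption. }
  assert (HGi : forall f, G f -> forall a b, f a = f b -> a = b).
  { intros f Gf. apply (increasing_group_inj K); auto. }
  assert (Hz : forall z, is_inverse (zpow g g' z) (zpow g g' (- z))).
  { intro; apply zpow_opp, Hg. }
  assert (Hzz : forall a b c x, (a + b = c)%Z ->
            zpow g g' a (zpow g g' b x) = zpow g g' c x).
  { intros a b c x <-. symmetry. apply zpow_add, Hg. }
  (* This is the translate of the cover by the power [z] of [g]; the choice of [g] makes these
     translates disjoint. *)
  set (Sz := fun z x => covers l (zpow g g' (- z) x)).
  assert (Hdis : forall i j x, Sz i x -> Sz j x -> i = j).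
  { intros i j x Hi Hj.
    assert (i - j = 0)%Z; [|lia].
    apply (zpow_displaces g g' (covers l) _ (zpow g g' (- i) x)); trivial.
    rewrite (Hzz _ _ (- j)%Z) by lia. assumption. }
  pose proof Hphi as (Hin & Hmul & Hinj).
  assert (Hps : forall w, Win n w -> supported_in (covers l) (phi w)).
  { intros w Hw. apply (supported_in_mono (covers l1)); [|auto].
    intros x Hx. apply covers_app; auto. }
  set (c := fun z h => conjugate (zpow g g' z) (zpow g g' (- z)) h).
  assert (Hcs : forall z w, Win n w -> supported_in (Sz z) (c z (phi w))).
  { intros z w Hw. apply (conj_supported (zpow g g' z) (zpow g g' (- z)) (covers l)); auto. }
  assert (HcG : forall z w, Win n w -> G (c z (phi w))).
  { intros z w Hw. unfold c, conjugate. apply gen_comp; [apply Gz|].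
    apply gen_comp; [|apply Gz]. apply HTG; auto. }
  set (gl := glue Z (inhabits 0%Z) Sz).
  exists (g :: T), (fun w => comp (gl (fun z => c z (phi (fst w z)))) (zpow g g' (snd w))).
  split; [|split; [|split]].
  - intros f Hf. apply HGK, gen_base, Hf.
  - intros [f m] [Hf (N & HN)]; simpl in *.
    apply gen_comp; [|apply Gz].
    apply (glue_closed Z (inhabits 0%Z) Sz Hdis G) with
      (* The list contains every integer of absolute value at most [N]. *)
      (L := map (fun k => (Z.of_nat k - N)%Z) (seq 0 (2 * Z.to_nat N + 1))).
    + apply gen_id.
    + apply gen_comp.
    + intro i; auto.
    + intro i; apply HGi; auto.
    + intro i; auto.
    + intros i Hi. rewrite HN.
      * rewrite (embedding_1 n G); trivial.
        -- apply functional_extensionality; intro x. apply Hz.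
        -- intros h Gh. apply HIK, HGK, Gh.
        -- split; [|split]; auto.
      * apply Z.nle_gt; intro Hle. apply Hi, in_map_iff.
        exists (Z.to_nat (i + N)). split; [lia|]. apply in_seq. lia.
  - intros [f m] [f' m'] [Hf _] [Hf' _]; simpl in *.
    (* Conjugation by the power [m] of [g] carries the translate of index [z - m] to that of index
       [z], which is the index shift in the wreath product. Off all translates both sides are the
       identity. *)
    assert (Hshift : gl (fun z => c z (phi (f' (z - m)%Z))) =
              c m (gl (fun z => c z (phi (f' z))))).
    { apply functional_extensionality; intro x.
      unfold c at 2, conjugate, comp at 1 2.
      destruct (classic (exists i, Sz i x)) as [[i Hx]|Hx].
      - unfold gl. rewrite (glue_in Z _ Sz Hdis _ i x Hx).
        rewrite (glue_in Z _ Sz Hdis _ (i - m)%Z).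
        + unfold c, conjugate, comp.
          rewrite (Hzz m (i - m)%Z i), (Hzz (- (i - m))%Z (- m)%Z (- i)%Z) by lia.
          reflexivity.
        + unfold Sz. rewrite (Hzz _ _ (- i)%Z) by lia. exact Hx.
      - unfold gl. rewrite !glue_out.
        + rewrite (Hzz _ _ 0%Z) by lia. reflexivity.
        + intro i; auto.
        + intros i Hi. apply Hx. exists (i + m)%Z. unfold Sz in *.
          rewrite (Hzz _ _ (- (i + m))%Z) in Hi by lia. assumption.
        + intro i; auto.
        + intros i Hi. eauto. }
    replace (fun z => c z (phi (Wmul n (f z) (f' (z - m)%Z)))) with
      (fun z => comp (c z (phi (f z))) (c z (phi (f' (z - m)%Z)))).
    + unfold gl. rewrite glue_comp; fold gl.
      * rewrite Hshift. apply functional_extensionality; intro x.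
        unfold c at 2, conjugate, comp. do 3 f_equal. apply Hzz; lia.
      * assumption.
      * intro i; auto.
      * intro i; auto.
      * intro i. apply HGi; auto.
    + apply functional_extensionality; intro z. unfold c.
      rewrite <- conj_comp, Hmul; auto.
  - intros [f m] [f' m'] [Hf _] [Hf' _] E; simpl in *.
    (* The power [m] of [g] takes [p] into the translate of index [m], which the glued map
       preserves; disjointness then determines [m]. *)
    assert (Hloc : forall f m, (forall z, Win n (f z)) ->
              Sz m (comp (gl (fun z => c z (phi (f z)))) (zpow g g' m) p)).
    { clear f m f' m' Hf Hf' E. intros f m Hf.
      assert (Hm : Sz m (zpow g g' m p)).
      { unfold Sz. rewrite (Hzz _ _ 0%Z) by lia. exact Hpl. }
      unfold comp, gl. rewrite (glue_in Z _ Sz Hdis _ m) by assumption.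
      apply supported_in_preserves; [apply HGi; auto|auto|assumption]. }
    assert (Em : m = m').
    { apply (Hdis _ _ _ (Hloc f m Hf)). rewrite E. auto. }
    subst m'. f_equal.
    assert (E' : gl (fun z => c z (phi (f z))) = gl (fun z => c z (phi (f' z)))).
    { apply functional_extensionality; intro x.
      apply (f_equal (fun h => h (zpow g g' (- m) x))) in E. unfold comp in E.
      rewrite (Hzz _ _ 0%Z) in E by lia. exact E. }
    apply functional_extensionality; intro z. apply Hinj; auto.
    apply (conj_inj (zpow g g' z) (zpow g g' (- z))); [auto|].
    apply (glue_inj Z (inhabits 0%Z) Sz Hdis
             (fun z => c z (phi (f z))) (fun z => c z (phi (f' z)))); trivial;
      intro i; auto.
Qed.

Lemma derived_sub n : forall K, subgroup_PLo K -> forall f, derived n K f -> K f.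
Proof.
  induction n as [|n IH]; intros K HK f Hf; [assumption|].
  rewrite <- derived_succ in Hf. apply derived1_sub; [assumption|].
  apply IH; [apply subgroup_derived1|]; assumption.
Qed.

(** The induction hypothesis is applied to the derived group, and [embedding_succ] returns to [K]
    with one more wreath factor. *)
Lemma embedding_of_derived n : forall K, subgroup_PLo K ->
  (exists f, derived n K f /\ f <> (fun x => x)) ->
  exists T phi, (forall f, In f T -> K f) /\
     embedding (S n) (gen (fun f => In f T)) phi.
Proof.
  assert (Hmoved : forall K (f : R -> R), K f -> f <> (fun x => x) ->
            exists p, ~ globally_fixed K p).
  { intros K f Kf Hne. apply NNPP; intro Hno. apply Hne.
    apply functional_extensionality; intro x. apply NNPP; intro Hx.
    apply Hno. exists x. intro Hfix. apply Hx, Hfix, Kf. }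
  induction n as [|n IH]; intros K HK (f & Hf & Hne);
    apply embedding_succ; trivial; [eauto | | |].
  (* The induction starts from the trivial group [Wty 0], generated by the empty list. *)
  - exists nil, (fun _ x => x). split; [intros h []|split; [|split]].
    + intros. apply gen_id.
    + reflexivity.
    + intros [] [] _ _ _; reflexivity.
  - apply (Hmoved K f); [apply (derived_sub (S n))|]; assumption.
  - apply IH; [apply subgroup_derived1, HK|].
    rewrite derived_succ. eauto.
Qed.

(** * Direct sums *)

Lemma conj_embedding n K phi g g' :
  subgroup_PLo K -> K g -> K g' -> is_inverse g g' -> embedding n K phi ->
  embedding n K (fun w => conjugate g g' (phi w)).
Proof.
  intros HK Kg Kg' Hg (Hin & Hmul & Hinj). split; [|split].
  - intros w Hw. apply HK; [assumption|]. apply HK; auto.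
  - intros v w Hv Hw. rewrite Hmul by assumption. apply conj_comp, Hg.
  - intros v w Hv Hw E. apply Hinj; trivial. apply (conj_inj g g'); assumption.
Qed.

(** A global fixed point in the image of the cover would be fixed by [g'], hence lie in the cover
    itself. *)
Lemma fixed_point_free_image K g g' l :
  increasing_group K -> K g -> K g' -> is_inverse g g' -> fixed_point_free K l ->
  exists gl, fixed_point_free K gl /\ forall x, covers gl x <-> covers l (g' x).
Proof.
  intros (HI & H1 & HC & HV) Kg Kg' [E1 E2] [Hle Hfree].
  exists (map (fun I => (g (fst I), g (snd I))) l).
  assert (Hcov : forall x, covers (map (fun I => (g (fst I), g (snd I))) l) x <->
                           covers l (g' x)).
  { intros x; split.
    - intros (J & HJ & Hx). apply in_map_iff in HJ as (I & <- & HI').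
      exists I. split; [assumption|]. simpl in Hx.
      rewrite <- (E1 (fst I)), <- (E1 (snd I)).
      split; apply si_le; auto; apply Hx.
    - intros (I & HI' & Hx). exists (g (fst I), g (snd I)). split.
      + apply (in_map (fun I => (g (fst I), g (snd I)))); assumption.
      + simpl. rewrite <- (E2 x). split; apply si_le; auto; apply Hx. }
  split; [|assumption]. split.
  - intros J HJ. apply in_map_iff in HJ as (I & <- & HI'). simpl.
    apply si_le; auto.
  - intros x Hx Hfix. apply Hcov in Hx. apply (Hfree _ Hx).
    intros u Ku. rewrite (Hfix g' Kg'). apply Hfix, Ku.
Qed.

(** One derived group more than in [embedding_of_derived] puts the copy inside the derived group of
    [K], so that it has a cover [l1]. An element [g] of [K] that moves [l ++ l1] off itself then
    conjugates the copy away from [l]. *)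
Lemma disjoint_embedding n K l :
  subgroup_PLo K -> fixed_point_free K l ->
  (exists f, derived (S n) K f /\ f <> (fun x => x)) ->
  exists (phi : Wty (S n) -> R -> R) l', embedding (S n) K phi /\ fixed_point_free K l' /\
    (forall w, Win (S n) w -> supported_in (covers l') (phi w)) /\
    (forall x, covers l' x -> ~ covers l x).
Proof.
  intros HK F Hder. rewrite <- derived_succ in Hder.
  pose proof (subgroup_increasing K HK) as HIK.
  destruct (embedding_of_derived n _ (subgroup_derived1 K HK) Hder)
    as (T & phi & HT & Hin & Hmul & Hinj).
  destruct (derived_list_support K T HK HT) as (l1 & F1 & S1).
  destruct (displace_cover K (l ++ l1) HIK) as (g & Kg & Hd).
  { apply fixed_point_free_app; assumption. }
  assert (Hg' : exists g', K g' /\ is_inverse g g') by (apply HIK, Kg).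
  destruct Hg' as (g' & Kg' & Hg).
  destruct (fixed_point_free_image K g g' l1) as (l2 & F2 & C2); trivial.
  exists (fun w => conjugate g g' (phi w)), l2. split; [|split; [assumption|split]].
  - apply conj_embedding; trivial. split; [|split]; trivial.
    intros w Hw. apply derived1_sub; [assumption|].
    apply (gen_sub (derived 1 K) (fun f => In f T)); auto.
    apply subgroup_derived1, HK.
  - intros w Hw. apply (supported_in_mono (fun x => covers l1 (g' x))).
    + intros x Hx. apply C2, Hx.
    + apply conj_supported; auto.
  - intros x Hx Hlx. apply C2 in Hx. apply (Hd 0%nat (g' x)); apply covers_app; auto.
    left. simpl. unfold comp. rewrite (proj2 Hg). assumption.
Qed.

Lemma contains_W_of_not_solvable H :
  subgroup_PLo H -> ~ solvable H -> contains_copy_of_W H.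
Proof.
  intros HH Hns.
  assert (Hder : forall n, exists f, derived n H f /\ f <> (fun x => x)).
  { intro n. apply NNPP; intro Hno. apply Hns. exists n. intros f Hf.
    apply NNPP; eauto. }
  set (P := fun j (l : list (R * R)) (q : (Wty (S j) -> R -> R) * list (R * R)) =>
    embedding (S j) H (fst q) /\ fixed_point_free H (snd q) /\
    (forall w, Win (S j) w -> supported_in (covers (snd q)) (fst q w)) /\
    (forall x, covers (snd q) x -> ~ covers l x)).
  (* The list is bundled with the proof that it avoids the global fixed points, since the next
     choice in the recursion depends on that proof. *)
  assert (step : forall j (l : {l | fixed_point_free H l}), {q | P j (proj1_sig l) q}).
  { intros j [l F]. apply constructive_indefinite_description.
    destruct (disjoint_embedding j H l HH F (Hder (S j))) as (phi & l' & Hp).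
    exists (phi, l'). exact Hp. }
  assert (F0 : fixed_point_free H nil).
  { split; [intros I []|intros x (I & [] & _)]. }
  set (next := fun j (l : {l | fixed_point_free H l}) =>
    exist (fixed_point_free H) (proj1_sig l ++ snd (proj1_sig (step j l)))
      (fixed_point_free_app H _ _ (proj2_sig l)
         (proj1 (proj2 (proj2_sig (step j l)))))).
  (* [used j] accumulates the covers of all copies of index below [j], and the copy of index [j] is
     chosen off them. *)
  set (used := fix used j := match j with
                             | O => exist (fixed_point_free H) nil F0
                             | S k => next k (used k)
                             end).
  set (phi := fun j => fst (proj1_sig (step j (used j)))).
  set (Sj := fun j => covers (snd (proj1_sig (step j (used j))))).
  assert (Hphi : forall j, embedding (S j) H (phi j)).
  { intro j. exact (proj1 (proj2_sig (step j (used j)))). }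
  assert (Hsup : forall j w, Win (S j) w -> supported_in (Sj j) (phi j w)).
  { intro j. exact (proj1 (proj2 (proj2 (proj2_sig (step j (used j)))))). }
  assert (Hnew : forall j x, Sj j x -> ~ covers (proj1_sig (used j)) x).
  { intro j. exact (proj2 (proj2 (proj2 (proj2_sig (step j (used j)))))). }
  assert (Hused : forall i j x, (i < j)%nat -> Sj i x -> covers (proj1_sig (used j)) x).
  { intros i j x Hij Hx. induction Hij as [|j Hij IH]; simpl; apply covers_app; auto. }
  assert (Hdis : forall i j x, Sj i x -> Sj j x -> i = j).
  { intros i j x Hi Hj. destruct (Nat.lt_trichotomy i j) as [Hij|[Hij|Hij]]; trivial.
    - destruct (Hnew j x Hj (Hused i j x Hij Hi)).
    - destruct (Hnew i x Hi (Hused j i x Hij Hj)). }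
  pose proof (subgroup_increasing H HH) as HIH.
  set (gl := glue nat (inhabits 0%nat) Sj).
  exists (fun w => gl (fun j => phi j (w j))). split; [|split].
  - intros w [Hw (N & HN)].
    apply (glue_closed nat (inhabits 0%nat) Sj Hdis H) with (L := seq 0 (S N));
      try apply HH.
    + intro j; auto.
    + intro j. apply (increasing_group_inj H); [assumption|]. apply Hphi; auto.
    + intro j. apply Hphi; auto.
    + intros j Hj. rewrite HN.
      * apply (embedding_1 _ H); [apply HIH|apply Hphi].
      * apply Nat.nle_gt; intro Hle. apply Hj, in_seq. lia.
  - intros v w [Hv _] [Hw _]. unfold gl. rewrite <- glue_comp; trivial.
    + f_equal. apply functional_extensionality_dep; intro j.
      apply Hphi; auto.
    + intro j; auto.
    + intro j; auto.
    + intro j. apply (increasing_group_inj H); [assumption|]. apply Hphi; auto.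
  - intros v w [Hv _] [Hw _] E. apply functional_extensionality_dep; intro j.
    apply (Hphi j); auto.
    apply (glue_inj nat (inhabits 0%nat) Sj Hdis
             (fun j => phi j (v j)) (fun j => phi j (w j))); trivial;
      intro i; auto.
Qed.

(** * Derived series of iterated wreath products *)

(* [rho] is the graph of a surjection from a subgroup onto [Wty (S n)],
   attained on [K].  It induces one from a subgroup of the derived group of [K]
   onto [Wty n]: the coordinate 0 of the commutator of an element of the base
   supported at 0 with the shift is arbitrary. *)
Lemma derived_nontrivial n :
  forall (K : (R -> R) -> Prop) (rho : (R -> R) -> Wty (S n) -> Prop),
  (forall k k' w w', rho k w -> rho k' w' -> rho (comp k k') (Wmul (S n) w w')) ->
  (forall k k' w, rho k w -> is_inverse k k' -> rho k' (Winv (S n) w)) ->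
  (forall w, rho (fun x => x) w -> w = Wone (S n)) ->
  (forall w, Win (S n) w -> exists k k', K k /\ is_inverse k k' /\ rho k w) ->
  exists f, derived n K f /\ f <> (fun x => x).
Proof.
  induction n as [|n IH]; intros K rho Hmul Hinv Hone Hsurj.
  - destruct (Hsurj (fun _ => tt, 1%Z)) as (k & k' & Kk & _ & Hk).
    { split; simpl; [trivial|]. exists 0%Z; intros; reflexivity. }
    exists k. split; [assumption|]. intros ->.
    pose proof (f_equal snd (Hone _ Hk)). discriminate.
  - rewrite <- derived_succ.
    apply (IH (derived 1 K) (fun k w => exists f, rho k (f, 0%Z) /\ f 0%Z = w)).
    + intros k k' w w' (f & Hf & <-) (f' & Hf' & <-).
      exists (fun z => Wmul (S n) (f z) (f' (z - 0)%Z)). split; [|reflexivity].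
      apply (Hmul _ _ _ _ Hf Hf').
    + intros k k' w (f & Hf & <-) Hk.
      exists (fun z => Winv (S n) (f (z + 0)%Z)). split; [|reflexivity].
      apply (Hinv _ _ _ Hf Hk).
    + intros w (f & Hf & <-). 
      exact (f_equal (fun v => fst v 0%Z) (Hone _ Hf)).
    + intros w Hw.
      (* The entry at 0 is the inverse of [w] because the commutator begins with the inverse of [a];
         the shifted copy of [d] has its entry at -1 and does not affect coordinate 0. *)
      set (d := fun z => if Z.eq_dec z 0 then Winv (S n) w else Wone (S n)).
      destruct (Hsurj (d, 0%Z)) as (a & a' & Ka & Ia & Ra).
      { split.
        - intro z. simpl fst. unfold d. destruct (Z.eq_dec z 0); [apply Win_inv, Hw|apply Win_1].
        - exists 0%Z. intros z Hz. simpl fst. unfold d.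
          destruct (Z.eq_dec z 0); [lia|reflexivity]. }
      destruct (Hsurj (fun _ => Wone (S n), 1%Z)) as (b & b' & Kb & Ib & Rb).
      { split; [intro; apply Win_1|]. exists 0%Z; intros; reflexivity. }
      exists (comp a' (comp b' (comp a b))), (comp b' (comp a' (comp b a))).
      split; [|split].
      * apply gen_base. exists a, b, a', b'. auto 6.
      * destruct Ia as [A1 A2], Ib as [B1 B2]. unfold comp.
        split; intro x.
        -- rewrite A2, B2, A1. apply B1.
        -- rewrite B2, A2, B1. apply A1.
      * pose proof (Hmul _ _ _ _ (Hinv _ _ _ Ra Ia)
          (Hmul _ _ _ _ (Hinv _ _ _ Rb Ib) (Hmul _ _ _ _ Ra Rb))) as Hc.
        eexists; split; [exact Hc|].
        change (Wmul (S n) (Winv (S n) (Winv (S n) w))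
                  (Wmul (S n) (Winv (S n) (Wone (S n)))
                     (Wmul (S n) (Wone (S n)) (Wone (S n)))) = w).
        rewrite Winv_1, !Wmul_1_r. apply Winv_involutive.
Qed.

(** This is the inclusion of a summand; the type varies with the index, so [w] is transported along
    the equality of indices. *)
Definition component (n : nat) (w : Wty (S n)) : Wsum :=
  fun j => match Nat.eq_dec n j with
           | left E => eq_rect n (fun j => Wty (S j)) w j E
           | right _ => Wone (S j)
           end.

Lemma component_at n w : component n w n = w.
Proof.
  unfold component. destruct (Nat.eq_dec n n) as [E|]; [|congruence].
  rewrite (Eqdep_dec.UIP_refl_nat n E). reflexivity.
Qed.

Lemma component_in n w : Win (S n) w -> Wsum_in (component n w).
Proof.
  intros Hw. split.
  - intros j. unfold component. destruct (Nat.eq_dec n j) as [E|].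
    + destruct E. assumption.
    + apply Win_1.
  - exists n. intros j Hj. unfold component.
    destruct (Nat.eq_dec n j); [lia|reflexivity].
Qed.

Lemma component_mul n v w :
  component n (Wmul (S n) v w) = Wsum_mul (component n v) (component n w).
Proof.
  apply functional_extensionality_dep; intro j. unfold Wsum_mul, component.
  destruct (Nat.eq_dec n j) as [E|].
  - destruct E. reflexivity.
  - symmetry. apply Wmul_1_l.
Qed.

(** If the derived group of index [n] is trivial, the single summand [Wty (S n)] already gives a
    contradiction. *)
Lemma not_solvable_of_contains_W H :
  subgroup_PLo H -> contains_copy_of_W H -> ~ solvable H.
Proof.
  intros HH (phi & Hin & Hmul & Hinj) (n & Hn).
  set (psi := fun w => phi (component n w)).
  assert (Hpsi : embedding (S n) H psi).
  { split; [|split].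
    - intros w Hw. apply Hin, component_in, Hw.
    - intros v w Hv Hw. unfold psi. rewrite component_mul.
      apply Hmul; apply component_in; assumption.
    - intros v w Hv Hw E. apply Hinj in E; [|apply component_in; assumption..].
      rewrite <- (component_at n v), E. apply component_at. }
  pose proof (subgroup_increasing H HH) as HIH.
  assert (H1 : psi (Wone (S n)) = (fun x => x)).
  { apply (embedding_1 _ H); [apply HIH|assumption]. }
  destruct Hpsi as (Pin & Pmul & Pinj).
  assert (Pinv : forall w, Win (S n) w -> is_inverse (psi w) (psi (Winv (S n) w))).
  { intros w Hw. pose proof (Win_inv _ _ Hw) as Hw'. split; intro x.
    - change (comp (psi (Winv (S n) w)) (psi w) x = x).
      rewrite <- Pmul, Wmul_Vl, H1; trivial.
    - change (comp (psi w) (psi (Winv (S n) w)) x = x).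
      rewrite <- Pmul, Wmul_Vr, H1; trivial. }
  (* The relation is the graph of the inverse of [psi], defined on the image of [psi]. *)
  destruct (derived_nontrivial n H (fun k w => Win (S n) w /\ k = psi w))
    as (f & Hf & Hne).
  - intros k k' v w [Hv ->] [Hw ->]. split; [apply Win_mul|symmetry; apply Pmul]; assumption.
  - intros k k' w [Hw ->] Hk. split; [apply Win_inv, Hw|].
    apply (inverse_unique (psi w)); auto.
  - intros w [Hw E]. apply Pinj; [assumption|apply Win_1|]. rewrite H1. auto.
  - intros w Hw. exists (psi w), (psi (Winv (S n) w)). auto.
  - apply Hne, Hn, Hf.
Qed.

Theorem theorem2 (H : (R -> R) -> Prop) (HH : subgroup_PLo H) :
  ~ solvable H <-> contains_copy_of_W H.
Proof.
  split; [apply contains_W_of_not_solvable|apply not_solvable_of_contains_W]; assumption.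
Qed.
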